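(* Let $I\subset[0,\infty)$ be an interval with interior $I^{\circ}$, and let $f:I\to\mathbb{R}$ be a twice differentiable function on $I^{\circ}$ such that $f''\in L[a,b]$, where $a/m,b\in I^{\circ}$ with $a<mb$. Suppose $|f''|^{q}$ is $(\alpha,m)$-convex on $[a,b]$ for some fixed $\alpha\in[0,1]$, $m\in(0,1]$ and $q\ge1$. Then for all $x\in[a,mb]$, $\lambda\in[0,1]$ and $\kappa>0$, $$|I_f(x,\lambda,\kappa;a,mb)|\le \varphi_1(\kappa,\lambda)^{1-\frac1q}\Big\{\frac{(x-a)^{\kappa+2}}{(\kappa+1)(mb-a)}\Big(|f''(x)|^{q}\varphi_2(\kappa,\lambda,\alpha)+m\big|f''\big(\tfrac am\big)\big|^{q}\varphi_3(\kappa,\lambda,\alpha)\Big)^{\frac1q}+\frac{(mb-x)^{\kappa+2}}{(\kappa+1)(mb-a)}\Big(|f''(x)|^{q}\varphi_2(\kappa,\lambda,\alpha)+m|f''(b)|^{q}\varphi_3(\kappa,\lambda,\alpha)\Big)^{\frac1q}\Big\},$$ where $$\varphi_1(\kappa,\lambda)=\begin{cases}\frac{\kappa[(\kappa+1)\lambda]^{\frac{\kappa+2}{\kappa}}}{\kappa+2}-\frac{(\kappa+1)\lambda}{2}+\frac1{\kappa+2}, & 0\le\lambda\le\frac1{\kappa+1},\\ \frac{(\kappa+1)\lambda}{2}-\frac1{\kappa+2}, & \frac1{\kappa+1}<\lambda\le1,\end{cases}$$ $$\varphi_2(\kappa,\lambda,\alpha)=\begin{cases}\frac{2\kappa[(\kappa+1)\lambda]^{\frac{\kappa+\alpha+2}{\kappa}}}{(\alpha+2)(\kappa+\alpha+2)}-\frac{(\kappa+1)\lambda}{\alpha+2}+\frac1{\kappa+\alpha+2},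 & 0\le\lambda\le\frac1{\kappa+1},\\ \frac{(\kappa+1)\lambda}{\alpha+2}-\frac1{\kappa+\alpha+2}, & \frac1{\kappa+1}<\lambda\le1,\end{cases}$$ $$\varphi_3(\kappa,\lambda,\alpha)=\begin{cases}\frac{\kappa[(\kappa+1)\lambda]^{\frac{\kappa+2}{\kappa}}}{\kappa+2}-\frac{2\kappa[(\kappa+1)\lambda]^{\frac{\kappa+\alpha+2}{\kappa}}}{(\alpha+2)(\kappa+\alpha+2)}-\frac{\alpha(\kappa+1)\lambda}{2(\alpha+2)}+\frac{\kappa}{(\kappa+2)(\kappa+\alpha+2)}, & 0\le\lambda\le\frac1{\kappa+1},\\ \frac{\alpha(\kappa+1)\lambda}{2(\alpha+2)}-\frac{\kappa}{(\kappa+2)(\kappa+\alpha+2)}, & \frac1{\kappa+1}<\lambda\le1.\end{cases}$$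
   Context: $L[a,b]$ is the space of Lebesgue integrable functions on $[a,b]$. A real function $g$ is $(\alpha,m)$-convex on $[a,b]$ if $g(tu+m(1-t)v)\le t^{\alpha}g(u)+m(1-t^{\alpha})g(v)$ for all $u,v\in[a,b]$ and $t\in[0,1]$ with $tu+m(1-t)v\in[a,b]$. For $\kappa>0$ the Riemann–Liouville integrals are $J_{u^+}^{\kappa}f(v)=\frac{1}{\Gamma(\kappa)}\int_u^v (v-t)^{\kappa-1}f(t)\,dt$ for $v>u$ and $J_{u^-}^{\kappa}f(v)=\frac{1}{\Gamma(\kappa)}\int_v^u (t-v)^{\kappa-1}f(t)\,dt$ for $v<u$ (both taken to be $0$ when $u=v$), where $\Gamma$ is the Gamma function. Define $$I_f(x,\lambda,\kappa;a,mb)=(1-\lambda)\frac{(x-a)^{\kappa}+(mb-x)^{\kappa}}{mb-a}f(x)+\lambda\,\frac{(x-a)^{\kappa}f(a)+(mb-x)^{\kappa}f(mb)}{mb-a}+\Big(\frac1{\kappa+1}-\lambda\Big)\frac{(mb-x)^{\kappa+1}-(x-a)^{\kappa+1}}{mb-a}f'(x)-\frac{\Gamma(\kappa+1)}{mb-a}\big[J_{x^-}^{\kappa}f(a)+J_{x^+}^{\kappa}f(mb)\big].$$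
   Formalization: In φ₃ the last fraction has numerator α, not κ, in both cases: as printed the claim fails for f(y)=y²/2, a=m=x=λ=κ=q=1, b=2, α=0 (1/3 > 5/18). It is also made explicit that [a,b] ⊂ I°, so that f'' is defined on [a,b]. *)

(* Defs.v *)
From HB Require Import structures.
From mathcomp Require Import all_boot all_order all_algebra.
From mathcomp Require Import all_classical all_reals all_analysis.

Set Implicit Arguments.
Unset Strict Implicit.
Unset Printing Implicit Defensive.

Import Order.TTheory GRing.Theory Num.Theory.
Import numFieldNormedType.Exports.

Local Open Scope classical_set_scope.
Local Open Scope ring_scope.

(* Bases of [`^] are nonnegative throughout. In the library [0 `^ 0 = 1], which
   is the convention used for [t `^ alpha] when [alpha = t = 0]. *)

Definition am_convex (R : realType) (alpha m a b : R) (g : R -> R) : Prop :=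
  forall u v t : R,
    u \in `[a, b] -> v \in `[a, b] -> t \in `[0, 1] ->
    t * u + m * (1 - t) * v \in `[a, b] ->
    g (t * u + m * (1 - t) * v) <=
      t `^ alpha * g u + m * (1 - t `^ alpha) * g v.

(* Euler's Gamma function; meaningful for [0 < z]. *)
Definition Gamma (R : realType) (z : R) : R :=
  \int[lebesgue_measure]_(t in `]0, +oo[) (t `^ (z - 1) * expR (- t)).

(* [RL_right u kappa f v] is J_{u^+}^kappa f(v), for [u <= v], and
   [RL_left u kappa f v] is J_{u^-}^kappa f(v), for [v <= u]. Both vanish for
   [u = v], the domain of integration being a singleton. *)
Definition RL_right (R : realType) (u kappa : R) (f : R -> R) (v : R) : R :=
  (Gamma kappa)^-1 *
    \int[lebesgue_measure]_(t in `[u, v]) ((v - t) `^ (kappa - 1) * f t).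

Definition RL_left (R : realType) (u kappa : R) (f : R -> R) (v : R) : R :=
  (Gamma kappa)^-1 *
    \int[lebesgue_measure]_(t in `[v, u]) ((t - v) `^ (kappa - 1) * f t).

(* I_f(x, lambda, kappa; a, c); used with [c = m * b]. *)
Definition If (R : realType) (f : R -> R) (x lambda kappa a c : R) : R :=
  (1 - lambda) * (((x - a) `^ kappa + (c - x) `^ kappa) / (c - a)) * f x
  + lambda * (((x - a) `^ kappa * f a + (c - x) `^ kappa * f c) / (c - a))
  + ((kappa + 1)^-1 - lambda)
      * (((c - x) `^ (kappa + 1) - (x - a) `^ (kappa + 1)) / (c - a))
      * derive1 f x
  - Gamma (kappa + 1) / (c - a) * (RL_left x kappa f a + RL_right x kappa f c).

(* With c = (kappa + 1) * lambda, for t in [0, 1],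
     phi1 is the integral of |t (c - t^kappa)|,
     phi2 is the integral of |t (c - t^kappa)| t^alpha,
     phi3 is the integral of |t (c - t^kappa)| (1 - t^alpha),
   the cases being whether c - t^kappa changes sign on [0, 1]. *)
Definition phi1 (R : realType) (kappa lambda : R) : R :=
  if lambda <= (kappa + 1)^-1 then
    kappa * ((kappa + 1) * lambda) `^ ((kappa + 2) / kappa) / (kappa + 2)
    - (kappa + 1) * lambda / 2 + (kappa + 2)^-1
  else (kappa + 1) * lambda / 2 - (kappa + 2)^-1.

Definition phi2 (R : realType) (kappa lambda alpha : R) : R :=
  if lambda <= (kappa + 1)^-1 then
    2 * kappa * ((kappa + 1) * lambda) `^ ((kappa + alpha + 2) / kappa)
      / ((alpha + 2) * (kappa + alpha + 2))
    - (kappa + 1) * lambda / (alpha + 2) + (kappa + alpha + 2)^-1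
  else (kappa + 1) * lambda / (alpha + 2) - (kappa + alpha + 2)^-1.

(* The numerator of the last fraction is [alpha] in both cases:
     1 / (kappa + 2) - 1 / (kappa + alpha + 2)
       = alpha / ((kappa + 2) * (kappa + alpha + 2)),
   so that phi3 = phi1 - phi2. The source prints [kappa] there, with which the
   inequality fails: take f y = y^2 / 2, a = 1, b = 2, m = 1, x = 1,
   lambda = kappa = q = 1 and alpha = 0, where |I_f| = 1/3 but the right-hand
   side would be 5/18. *)
Definition phi3 (R : realType) (kappa lambda alpha : R) : R :=
  if lambda <= (kappa + 1)^-1 then
    kappa * ((kappa + 1) * lambda) `^ ((kappa + 2) / kappa) / (kappa + 2)
    - 2 * kappa * ((kappa + 1) * lambda) `^ ((kappa + alpha + 2) / kappa)
        / ((alpha + 2) * (kappa + alpha + 2))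
    - alpha * (kappa + 1) * lambda / (2 * (alpha + 2))
    + alpha / ((kappa + 2) * (kappa + alpha + 2))
  else
    alpha * (kappa + 1) * lambda / (2 * (alpha + 2))
    - alpha / ((kappa + 2) * (kappa + alpha + 2)).

(* Main.v *)
Require Import Defs.
From HB Require Import structures.
From mathcomp Require Import all_boot all_order all_algebra.
From mathcomp Require Import all_classical all_reals all_analysis.
From mathcomp Require Import measurable_realfun ring lra.

Set Implicit Arguments.
Unset Strict Implicit.
Unset Printing Implicit Defensive.

Import Order.TTheory GRing.Theory Num.Theory.
Import numFieldNormedType.Exports.

Local Open Scope classical_set_scope.
Local Open Scope ring_scope.

(* Write c = (kappa + 1) lambda and k(t) = t (c - t^kappa). On each of the
   segments [a, x] and [x, m b], parametrised by t in [0, 1] from the outer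
   endpoint to x, the corresponding half of I_f is, up to the factor
   h^kappa / (kappa + 1) with h the length of the segment, the increment over
   [0, 1] of
     Phi = k F' - k' F - kappa (kappa + 1) int_0^t s^(kappa - 1) F(s) ds,
   where F is f along the segment, and Phi' = k F''.
   Convexity gives |F''(t)| <= h^2 y(t)^(1/q) with y affine in t^alpha. Instead
   of applying Hoelder's inequality to an integral of F'', bound y^(1/q) by the
   tangent line of the concave function y |-> y^(1/q) at an arbitrary point z^q:
   this makes the bound on |Phi'| a combination of |k| and |k| t^alpha, which
   have explicit primitives with increments phi1 and phi2, so that the increment
   of Phi is controlled by the mean value theorem. Optimising over z gives the
   Hoelder form. *)

(** * Integrals over an increasing union of compact intervals *)

Section exhaustion.
Context {R : realType}.
Notation mu := (@lebesgue_measure R).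
Variables (D : set R) (s r : nat -> R).
Hypotheses (sr : forall n, s n < r n) (s_dec : nonincreasing_seq s)
  (r_inc : nondecreasing_seq r).
Hypothesis DE : D = \bigcup_n `[s n, r n]%classic.

Let subD n : `[s n, r n] `<=` D.
Proof. by rewrite DE => x; exists n. Qed.

Let nested : nondecreasing_seq (fun n => `[s n, r n]%classic : set R).
Proof.
move=> n k nk; rewrite subsetEset; apply: subset_itvScc.
- by rewrite bnd_simp; exact: s_dec.
- by rewrite bnd_simp; exact: r_inc.
Qed.

Let mD : measurable D.
Proof. by rewrite DE; apply: bigcup_measurable. Qed.

Let within_S (u : R -> R) n : (forall x, D x -> {for x, continuous u}) ->
  {within `[s n, r n], continuous u}.
Proof.
move=> cu; apply: continuous_in_subspaceT => x /set_mem xs.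
exact/cu/(@subD n).
Qed.

Lemma exhaustion_measurable (u : R -> R) :
  (forall x, D x -> {for x, continuous u}) -> measurable_fun D u.
Proof.
move=> cu; rewrite DE; apply/measurable_fun_bigcup => // n.
by apply: subspace_continuous_measurable_fun => //; exact: within_S.
Qed.

Lemma exhaustion_cvg_integral (u : R -> R) :
  (forall x, D x -> {for x, continuous u}) -> (forall x, D x -> 0 <= u x) ->
  (\int[mu]_(x in `[s n, r n]) (u x)%:E @[n --> \oo] -->
    \int[mu]_(x in D) (u x)%:E)%E.
Proof.
move=> cu u0; rewrite [in X in _ --> X]DE.
apply: ge0_nondecreasing_set_cvg_integral => //.
- move=> n; apply/measurable_EFinP; apply: measurable_funS mD _ _ => //.
  exact: exhaustion_measurable.
- by move=> n x /subD Dx; rewrite lee_fin u0.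
Qed.

Lemma exhaustion_cvg_Rintegral (u : R -> R) :
  (forall x, D x -> {for x, continuous u}) -> (forall x, D x -> 0 <= u x) ->
  mu.-integrable D (EFin \o u) ->
  \int[mu]_(x in `[s n, r n]) u x @[n --> \oo] --> \int[mu]_(x in D) u x.
Proof.
move=> cu u0 iu; apply: fine_cvg; rewrite fineK.
  exact: exhaustion_cvg_integral.
exact: integrable_fin_num.
Qed.

Lemma exhaustion_FTC2 (u U : R -> R) n :
  (forall x, D x -> is_derive x 1 U (u x)) ->
  (forall x, D x -> {for x, continuous u}) ->
  (\int[mu]_(x in `[s n, r n]) (u x)%:E = (U (r n))%:E - (U (s n))%:E)%E.
Proof.
move=> dU cu; have dUS x : x \in `[s n, r n] -> derivable U x 1.
  by move=> xS; apply/ex_derive/dU/(@subD n).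
apply: continuous_FTC2 => //; first exact: within_S.
  have := derivable_within_continuous dUS.
  move/(continuous_within_itvP _ (sr n)) => [_ Us Ur]; split => // x xS.
  by apply: dUS; exact: subset_itv_oo_cc xS.
move=> x xS; rewrite derive1E; apply: derive_val; apply: dU.
by apply: (@subD n); exact: subset_itv_oo_cc xS.
Qed.

(** On each [[s n, r n]] the fundamental theorem gives an increment of [U], at most [B], and
    monotone convergence carries this bound to [D]. This covers an unbounded [u] or an unbounded
    [D]. *)
Lemma bounded_primitive_integrable (u U : R -> R) (B : R) :
  (forall x, D x -> is_derive x 1 U (u x)) ->
  (forall x, D x -> {for x, continuous u}) -> (forall x, D x -> 0 <= u x) ->
  (forall x, D x -> 0 <= U x <= B) ->
  mu.-integrable D (EFin \o u).
Proof.
move=> dU cu u0 UB; apply/integrableP; split.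
  by apply/measurable_EFinP; exact: exhaustion_measurable.
under eq_integral => x /set_mem Dx do rewrite /= ger0_norm ?u0//.
apply: (@le_lt_trans _ _ B%:E); last exact: ltry.
have cvgI := exhaustion_cvg_integral cu u0.
rewrite -(cvg_lim _ cvgI)//; apply: lime_le.
  by apply/cvg_ex; eexists; exact: cvgI.
apply: nearW => n; rewrite (exhaustion_FTC2 _ dU cu) -EFinB lee_fin.
have srn := ltW (sr n).
have /andP[_ Ur] : 0 <= U (r n) <= B.
  by apply/UB/(@subD n); rewrite /= in_itv/= srn lexx.
have /andP[Us _] : 0 <= U (s n) <= B.
  by apply/UB/(@subD n); rewrite /= in_itv/= srn lexx.
lra.
Qed.

End exhaustion.

(** * Derivatives and continuity of shifted powers *)

Lemma is_derive_ext (R : realType) (f g : R -> R) (x l l' : R) :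
  is_derive x 1 f l -> f =1 g -> l = l' -> is_derive x 1 g l'.
Proof. by move=> df /funext <- <-. Qed.

(** Yields the [n] for which a point lies in the exhausting intervals. The denominator starts at 2
    so that these intervals are nondegenerate already for n = 0. *)
Lemma invn_le_ex (R : realType) (B e : R) : 0 < e -> exists n, B / n.+2%:R <= e.
Proof.
move=> e0; exists (Num.truncn (B / e)).
rewrite ler_pdivrMr// mulrC -ler_pdivrMr//.
by rewrite (le_trans (ltW (truncnS_gt _)))// ler_nat.
Qed.

Lemma continuous_derive (R : realType) (f : R -> R) (x l : R) :
  is_derive x 1 f l -> {for x, continuous f}.
Proof.
by move=> fx; apply: differentiable_continuous; apply/derivable1_diffP/ex_derive.
Qed.

Lemma is_derive1_powR_sub (R : realType) (a k x : R) : a < x ->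
  is_derive x 1 (fun t => (t - a) `^ k) (k * (x - a) `^ (k - 1)).
Proof.
move=> ax; have xa : 0 < x - a by rewrite subr_gt0.
have := @is_derive1_comp R (@powR R ^~ k) (fun t => t - a) x _ _
  (is_derive1_powR k xa) (is_deriveB (is_derive_id x 1) (is_derive_cst a x 1)).
by rewrite subr0 mulr1.
Qed.

Lemma is_derive1_powR_rsub (R : realType) (c k x : R) : x < c ->
  is_derive x 1 (fun t => (c - t) `^ k) (- (k * (c - x) `^ (k - 1))).
Proof.
move=> xc; have cx : 0 < c - x by rewrite subr_gt0.
have := @is_derive1_comp R (@powR R ^~ k) (fun t => c - t) x _ _
  (is_derive1_powR k cx) (is_deriveB (is_derive_cst c x 1) (is_derive_id x 1)).
by rewrite sub0r mulrN1.
Qed.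

Lemma continuous_powR_sub (R : realType) (a k x : R) : a < x ->
  {for x, continuous (fun t => (t - a) `^ k)}.
Proof. by move=> ax; exact: continuous_derive (is_derive1_powR_sub k ax). Qed.

Lemma continuous_powR_rsub (R : realType) (c k x : R) : x < c ->
  {for x, continuous (fun t => (c - t) `^ k)}.
Proof. by move=> xc; exact: continuous_derive (is_derive1_powR_rsub k xc). Qed.

(** * Integrability of the Riemann-Liouville weights, singular at an endpoint when the exponent is
    negative *)

Section powR_integrable.
Context {R : realType}.
Notation mu := (@lebesgue_measure R).

Lemma nonincreasing_shrink (B : R) : 0 <= B ->
  nonincreasing_seq (fun n => B / n.+2%:R).
Proof.
by move=> B0 n k nk; rewrite ler_wpM2l// lef_pV2 ?posrE// ler_nat !ltnS.
Qed.

Lemma shrink_lt (B : R) n : 0 < B -> B / n.+2%:R < B.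
Proof. by move=> B0; rewrite ltr_pdivrMr// ltr_pMr// ltr1n. Qed.

Lemma powR_sub_integrable (a x k : R) : a < x -> 0 < k ->
  mu.-integrable `[a, x] (EFin \o (fun t => (t - a) `^ (k - 1))).
Proof.
move=> ax k0; have xa : 0 < x - a by rewrite subr_gt0.
have k_neq0 : k != 0 by rewrite gt_eqF.
set u : R -> R := fun t => (t - a) `^ (k - 1).
have Du t : `]a, x]%classic t -> is_derive t 1 (fun t => k^-1 * (t - a) `^ k) (u t).
  rewrite /= in_itv/= => /andP[at_ _].
  apply: (is_derive_ext (is_deriveZ k^-1 (is_derive1_powR_sub k at_))) => //.
  by rewrite /GRing.scale/= mulKf.
have cu t : `]a, x]%classic t -> {for t, continuous u}.
  by rewrite /= in_itv/= => /andP[at_ _]; exact: continuous_powR_sub.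
(* The singular endpoint has measure zero, so it can be removed; what is left is exhausted by
   compact intervals. *)
suff iu : mu.-integrable `]a, x] (EFin \o u).
  apply/integrableP; split.
    apply/measurable_EFinP/measurable_fun_itv_obnd_cbndP/measurable_EFinP.
    exact: (measurable_int mu).
  rewrite -integral_itv_obnd_cbnd; first by case/integrableP : iu.
  by apply: measurableT_comp => //; exact: (measurable_int mu).
pose s n := a + (x - a) / n.+2%:R.
have Ds : `]a, x]%classic = \bigcup_n `[s n, x]%classic.
  apply/seteqP; split => t /=; rewrite in_itv/=.
    move=> /andP[at_ tx].
    have [n sn] : exists n, (x - a) / n.+2%:R <= t - a.
      by apply: invn_le_ex; rewrite subr_gt0.
    by exists n => //=; rewrite in_itv/= tx andbT /s -lerBrDl.
  move=> [n _ /=]; rewrite in_itv/= => /andP[snt ->]; rewrite andbT.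
  by rewrite (lt_le_trans _ snt)// ltrDl divr_gt0.
apply: (@bounded_primitive_integrable _ _ s (fun=> x) _ _ _ Ds _
  (fun t => k^-1 * (t - a) `^ k) (k^-1 * (x - a) `^ k)) => //.
- by move=> n; rewrite /s -ltrBrDl shrink_lt.
- by move=> n m nm; rewrite lerD2l nonincreasing_shrink// ltW.
- by move=> t _; rewrite powR_ge0.
- move=> t /=; rewrite in_itv/= => /andP[at_ tx].
  have k_inv : 0 <= k^-1 by rewrite invr_ge0 ltW.
  rewrite mulr_ge0 ?powR_ge0//= ler_wpM2l//.
  by rewrite ge0_ler_powR ?nnegrE ?subr_ge0 ?lerD2r// ltW.
Qed.

Lemma powR_rsub_integrable (x c k : R) : x < c -> 0 < k ->
  mu.-integrable `[x, c] (EFin \o (fun t => (c - t) `^ (k - 1))).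
Proof.
move=> xc k0; have cx : 0 < c - x by rewrite subr_gt0.
have k_neq0 : k != 0 by rewrite gt_eqF.
set u : R -> R := fun t => (c - t) `^ (k - 1).
(* The additive constant makes the primitive vanish at [x], hence nonnegative on the interval, as
   [bounded_primitive_integrable] demands. *)
pose U t := k^-1 * (c - x) `^ k - k^-1 * (c - t) `^ k.
have Du t : `[x, c[%classic t -> is_derive t 1 U (u t).
  rewrite /= in_itv/= => /andP[_ tc].
  apply: (is_derive_ext (is_deriveB (is_derive_cst (k^-1 * (c - x) `^ k) t 1)
    (is_deriveZ k^-1 (is_derive1_powR_rsub k tc)))) => //.
  by rewrite sub0r /GRing.scale/= mulrN opprK mulKf.
have cu t : `[x, c[%classic t -> {for t, continuous u}.
  by rewrite /= in_itv/= => /andP[_ tc]; exact: continuous_powR_rsub.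
suff iu : mu.-integrable `[x, c[ (EFin \o u).
  apply/integrableP; split.
    apply/measurable_EFinP/measurable_fun_itv_bndo_bndcP/measurable_EFinP.
    exact: (measurable_int mu).
  rewrite -integral_itv_bndo_bndc; first by case/integrableP : iu.
  by apply: measurableT_comp => //; exact: (measurable_int mu).
pose r n := c - (c - x) / n.+2%:R.
have Dr : `[x, c[%classic = \bigcup_n `[x, r n]%classic.
  apply/seteqP; split => t /=; rewrite in_itv/=.
    move=> /andP[xt tc].
    have [n rn] : exists n, (c - x) / n.+2%:R <= c - t.
      by apply: invn_le_ex; rewrite subr_gt0.
    by exists n => //=; rewrite in_itv/= xt/= /r lerBrDr -lerBrDl.
  move=> [n _ /=]; rewrite in_itv/= => /andP[-> trn]/=.
  by rewrite (le_lt_trans trn)// ltrBlDr ltrDl divr_gt0.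
apply: (@bounded_primitive_integrable _ _ (fun=> x) r _ _ _ Dr _
  U (k^-1 * (c - x) `^ k)) => //.
- by move=> n; rewrite /r ltrBrDr -ltrBrDl shrink_lt.
- by move=> n m nm; rewrite lerD2l lerN2 nonincreasing_shrink// ltW.
- by move=> t _; rewrite powR_ge0.
- move=> t /=; rewrite in_itv/= => /andP[xt tc].
  have k_inv : 0 <= k^-1 by rewrite invr_ge0 ltW.
  rewrite subr_ge0 gerDl oppr_le0 mulr_ge0 ?powR_ge0//= andbT ler_wpM2l//.
  rewrite ge0_ler_powR ?nnegrE ?subr_ge0 ?lerD2l ?lerN2//.
  by rewrite ltW.
  by rewrite ltW.
  by rewrite (le_trans xt) ?ltW.
Qed.

End powR_integrable.

(** * The Gamma function: convergence, positivity, functional equation *)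

Section gamma_function.
Context {R : realType}.
Notation mu := (@lebesgue_measure R).
Implicit Types k t : R.

(** After taking logarithms this is ln u < u at u = t / k. *)
Lemma powR_le_expR k t : 0 < k -> 0 < t -> t `^ k <= k `^ k * expR t.
Proof.
move=> k0 t0; rewrite /powR !gt_eqF// -expRD ler_expR.
have -> : ln t = ln (t / k) + ln k by rewrite -lnM ?posrE ?divfK ?gt_eqF ?divr_gt0.
rewrite mulrDr addrC lerD2l mulrC -ler_pdivlMr//.
by apply/ltW/ln_sublinear; rewrite divr_gt0.
Qed.

Let s n : R := n.+2%:R^-1.
Let r n : R := n.+2%:R.

Let sr n : s n < r n.
Proof.
by rewrite (@lt_trans _ _ 1) ?invf_lt1// /r ?ltr1n ?ltr0n.
Qed.

Let s_dec : nonincreasing_seq s.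
Proof. by move=> n m nm; rewrite lef_pV2 ?posrE// ler_nat !ltnS. Qed.

Let r_inc : nondecreasing_seq r.
Proof. by move=> n m nm; rewrite ler_nat !ltnS. Qed.

Let DE : `]0, +oo[%classic = \bigcup_n `[s n, r n]%classic.
Proof.
apply/seteqP; split => t /=; rewrite in_itv/= andbT.
  move=> t0; have [i ti] := invn_le_ex 1 t0.
  have ti0 : 0 < t^-1 by rewrite invr_gt0.
  have [j tj] := invn_le_ex 1 ti0.
  exists (maxn i j) => //=; rewrite in_itv/=; apply/andP; split.
    by rewrite (le_trans _ ti)// mul1r; apply: s_dec; exact: leq_maxl.
  rewrite (@le_trans _ _ (r j))//; last by apply: r_inc; exact: leq_maxr.
  by rewrite -lef_pV2 ?posrE// (le_trans _ tj) ?mul1r.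
move=> [n _ /=]; rewrite in_itv/= => /andP[+ _].
by apply: lt_le_trans; rewrite invr_gt0.
Qed.

Let is_derive_expRN t : is_derive t 1 (fun t => expR (- t)) (- expR (- t)).
Proof.
have := @is_derive1_comp R expR -%R t _ _
  (is_derive_expR (- t)) (is_deriveNid t (1 : R)).
by move/is_derive_ext; apply => //; rewrite mulrN1.
Qed.

Let integrand k t := t `^ (k - 1) * expR (- t).

Let integrand_continuous k t : `]0, +oo[%classic t ->
  {for t, continuous (integrand k)}.
Proof.
rewrite /= in_itv/= andbT => t0.
exact: continuous_derive
  (is_deriveM (is_derive1_powR (k - 1) t0) (is_derive_expRN t)).
Qed.

Let integrand_ge0 k t : 0 <= integrand k t.
Proof. by rewrite mulr_ge0 ?powR_ge0 ?expR_ge0. Qed.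

(* The integrand is at most a constant times the derivative of the bounded
   function [t^k / (1 + t^k)]. *)
Lemma Gamma_integrable k : 0 < k -> mu.-integrable `]0, +oo[ (EFin \o integrand k).
Proof.
move=> k0; have k_neq0 : k != 0 by rewrite gt_eqF.
pose U t := 1 - (1 + t `^ k)^-1.
pose u t := (1 + t `^ k) ^- 2 * (k * t `^ (k - 1)).
have p1 t : 0 < 1 + t `^ k by rewrite ltr_pwDl ?powR_ge0.
have dpk t : 0 < t -> is_derive t 1 (fun t => 1 + t `^ k) (k * t `^ (k - 1)).
  move=> t0; apply: (is_derive_ext (is_deriveD (is_derive_cst (1 : R) t 1)
    (is_derive1_powR k t0))) => //.
  by rewrite add0r.
have dV t : 0 < t -> is_derive t 1 (fun t => (1 + t `^ k)^-1) (- u t).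
  move=> t0; have p1_neq0 : 1 + t `^ k != 0 by rewrite gt_eqF.
  apply: (is_derive_ext (@is_deriveV R (fun t => 1 + t `^ k) t _ _ p1_neq0
    (dpk _ t0))) => //.
  by rewrite /u -mulNr.
have Du t : `]0, +oo[%classic t -> is_derive t 1 U (u t).
  rewrite /= in_itv/= andbT => t0.
  apply: (is_derive_ext (is_deriveB (is_derive_cst (1 : R) t 1) (dV _ t0))) => //.
  by rewrite sub0r opprK.
have cu t : `]0, +oo[%classic t -> {for t, continuous u}.
  rewrite /= in_itv/= andbT => t0.
  have p2_neq0 : (1 + t `^ k) ^+ 2 != 0 by rewrite expf_neq0// gt_eqF.
  have dV2 := @is_deriveV R (fun t => (1 + t `^ k) ^+ 2) t _ _ p2_neq0
    (is_deriveX 2 (dpk _ t0)).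
  exact: (continuous_derive (is_deriveM dV2
    (is_deriveZ k (is_derive1_powR (k - 1) t0)))).
have iu : mu.-integrable `]0, +oo[ (EFin \o u).
  apply: (@bounded_primitive_integrable _ _ s r sr s_dec r_inc DE u U 1) => //.
  - by move=> t _; rewrite /u mulr_ge0 ?invr_ge0 ?exprn_ge0 ?mulr_ge0 ?powR_ge0 ?ltW.
  - move=> t _; rewrite /U subr_ge0 invf_le1// lerDl powR_ge0/=.
    by rewrite gerDl oppr_le0 invr_ge0 ltW.
(* Domination amounts to (1 + t^k)^2 <= C e^t. The three summands of [C] bound the terms 1, 2 t^k
   and t^(2k) of the expanded square, by [powR_le_expR] with exponents k and 2k. *)
pose C := 1 + 2 * k `^ k + (k + k) `^ (k + k).
have C0 : 0 < C by rewrite /C -addrA ltr_pwDl// addr_ge0 ?mulr_ge0 ?powR_ge0.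
apply: (le_integrable _ _ _ (integrableZl _ (C / k) iu)) => //.
  apply/measurable_EFinP; apply: (exhaustion_measurable DE) => t.
  exact: integrand_continuous.
move=> t; rewrite /= in_itv/= andbT => t0.
rewrite lee_fin ger0_norm// ger0_norm; last first.
  by rewrite mulr_ge0 ?divr_ge0 ?(ltW C0) ?(ltW k0)//
    /u mulr_ge0 ?invr_ge0 ?exprn_ge0 ?mulr_ge0 ?powR_ge0 ?ltW.
have -> : C / k * u t = t `^ (k - 1) * (C / (1 + t `^ k) ^+ 2).
  by rewrite /u; field; rewrite k_neq0 gt_eqF.
rewrite ler_wpM2l ?powR_ge0// ler_pdivlMr ?exprn_gt0// expRN.
rewrite ler_pdivrMl ?expR_gt0//.
have -> : (1 + t `^ k) ^+ 2 = 1 + 2 * t `^ k + t `^ (k + k).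
  by rewrite powRD ?(gt_eqF t0) ?implybT//; ring.
have e1 : 1 <= expR t by rewrite -expR0 ler_expR ltW.
have ek := powR_le_expR k0 t0.
have e2k := powR_le_expR (addr_gt0 k0 k0) t0.
rewrite /C; lra.
Qed.

(** The integrand has a positive minimum on [1, 2], an interval of length 1, so this minimum is a
    lower bound for the integral. *)
Lemma Gamma_gt0 k : 0 < k -> 0 < Gamma k.
Proof.
move=> k0; have ig := Gamma_integrable k0.
have sub : `[1 : R, 2] `<=` `]0, +oo[.
  by move=> t /=; rewrite !in_itv/= andbT => /andP[t1 _]; exact: lt_le_trans t1.
have [||c c12 cmin] := @EVT_min R (integrand k) 1 2; first exact: ler1n.
  by apply: continuous_in_subspaceT => t /set_mem /sub; exact: integrand_continuous.
have c0 : 0 < integrand k c.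
  rewrite mulr_gt0 ?expR_gt0 ?powR_gt0//.
  by move: c12; rewrite in_itv/= => /andP[c1 _]; exact: lt_le_trans c1.
apply: (lt_le_trans c0); rewrite /Gamma -[_ <= _]lee_fin fineK; last first.
  exact: integrable_fin_num.
apply: (@le_trans _ _ (\int[mu]_(t in `[1%R, 2%R]) (integrand k t)%:E)%E); last first.
  apply: ge0_subset_integral => //; first exact: (measurable_int mu).
  by move=> t _; rewrite lee_fin.
apply: (@le_trans _ _ (\int[mu]_(t in `[1%R, 2%R]) (integrand k c)%:E)%E).
  rewrite integral_cst//= lebesgue_measure_itv/= lte_fin ltr1n/= -EFinB -EFinM lee_fin.
  by rewrite (_ : 2 - 1 = 1) ?mulr1//; ring.
apply: ge0_le_integral => //.
- by move=> t _; rewrite lee_fin.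
- exact: measurable_funS sub (measurable_int mu ig).
Qed.

(** Integration by parts on [[s n, r n]], in the form of the fundamental theorem for t^k e^(-t); the
    boundary terms vanish in the limit. *)
Lemma Gamma_add1 k : 0 < k -> Gamma (k + 1) = k * Gamma k.
Proof.
move=> k0; have k10 : 0 < k + 1 by rewrite addr_gt0.
have ig := Gamma_integrable k0; have ig1 := Gamma_integrable k10.
have cvgI j : 0 < j ->
    \int[mu]_(t in `[s n, r n]) integrand j t @[n --> \oo] --> Gamma j.
  move=> j0; apply: (exhaustion_cvg_Rintegral s_dec r_inc DE) => //.
  - exact: integrand_continuous.
  - exact: Gamma_integrable.
have sub n : `[s n, r n] `<=` `]0, +oo[ by rewrite DE => t; exists n.
pose W t := t `^ k * expR (- t).
pose w t := k * integrand k t - integrand (k + 1) t.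
have IW n : k * \int[mu]_(t in `[s n, r n]) integrand k t -
    \int[mu]_(t in `[s n, r n]) integrand (k + 1) t = W (r n) - W (s n).
  have ikn : mu.-integrable `[s n, r n] (EFin \o integrand k).
    by apply: integrableS ig => //; exact: sub.
  have ik1n : mu.-integrable `[s n, r n] (EFin \o integrand (k + 1)).
    by apply: integrableS ig1 => //; exact: sub.
  rewrite -RintegralZl// -RintegralB//; last exact: (integrableZl _ k ikn).
  have dW t : `]0, +oo[%classic t -> is_derive t 1 W (w t).
    rewrite /= in_itv/= andbT => t0.
    apply: (is_derive_ext (is_deriveM (is_derive1_powR k t0)
      (is_derive_expRN t))) => //.
    by rewrite /w /integrand addrK /GRing.scale/=; ring.
  have cw t : `]0, +oo[%classic t -> {for t, continuous w}.
    move=> Dt; apply: continuousB; last exact: integrand_continuous.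
    by apply: continuousM; [exact: cst_continuous|exact: integrand_continuous].
  by rewrite /Rintegral (exhaustion_FTC2 sr DE n dW cw).
have s0 : s n @[n --> \oo] --> 0.
  by have := @cvg_harmonic R; rewrite -(cvg_shiftS (@harmonic R)).
have Wr : W (r n) @[n --> \oo] --> 0.
  (* One power more than in [W]: t^(k+1) <= C e^t gives W(t) <= C / t. *)
  pose C := (k + 1) `^ (k + 1).
  apply: (@squeeze_cvgr _ _ _ _ (fun=> 0) (fun n => C * n.+2%:R^-1)).
  - apply: nearW => n; rewrite mulr_ge0 ?powR_ge0 ?expR_ge0//=.
    rewrite ler_pdivlMr// /W expRN mulrAC ler_pdivrMr ?expR_gt0//.
    rewrite (le_trans _ (powR_le_expR k10 _))// powRD ?powRr1//.
    by rewrite pnatr_eq0 implybT.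
  - exact: cvg_cst.
  - by rewrite -[X in _ --> X](mulr0 C); apply: cvgM; [exact: cvg_cst|].
have Ws : W (s n) @[n --> \oo] --> 0.
  apply: (@squeeze_cvgr _ _ _ _ (fun=> 0) (fun n => s n `^ k)).
  - apply: nearW => n; rewrite mulr_ge0 ?powR_ge0 ?expR_ge0//=.
    by rewrite ler_piMr ?powR_ge0// expR_le1 oppr_le0 invr_ge0.
  - exact: cvg_cst.
  - have /cvg_at_rightP := powR_cvg0 k0.
    by apply; split=> // n; rewrite invr_gt0.
have L1 : k * \int[mu]_(t in `[s n, r n]) integrand k t -
    \int[mu]_(t in `[s n, r n]) integrand (k + 1) t @[n --> \oo]
    --> k * Gamma k - Gamma (k + 1).
  by apply: cvgB (cvgI _ k10); apply: cvgM (cvgI _ k0); exact: cvg_cst.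
have L2 : W (r n) - W (s n) @[n --> \oo] --> (0 - 0 : R) by exact: cvgB.
rewrite -(funext IW) in L2.
have L : k * Gamma k - Gamma (k + 1) = 0 - 0 by exact: cvg_unique L1 L2.
by apply/esym/subr0_eq; rewrite L subr0.
Qed.

End gamma_function.

(** * Comparison of increments, and continuity on closed intervals *)

Section interval_lemmas.
Context {R : realType}.

(** The mean value theorem for G + F and G - F, whose derivatives are nonnegative, gives the two
    one-sided bounds. It stands in for bounding the integral of [dF] by that of [dG]. *)
Lemma ler_dist_derive (F G dF dG : R -> R) (a b : R) : a <= b ->
  {within `[a, b], continuous F} -> {within `[a, b], continuous G} ->
  (forall t, a < t < b -> is_derive t 1 F (dF t)) ->
  (forall t, a < t < b -> is_derive t 1 G (dG t)) ->
  (forall t, a < t < b -> `|dF t| <= dG t) ->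
  `|F b - F a| <= G b - G a.
Proof.
rewrite le_eqVlt => /predU1P[->|ab]; first by rewrite !subrr normr0.
move=> cF cG dFP dGP FG; rewrite ler_norml; apply/andP; split.
- have [t||t tab tE] := @MVT R (G + F) (dG + dF) a b ab.
  + rewrite in_itv/= => tab.
    exact: is_deriveD (dGP _ tab) (dFP _ tab).
  + by move=> t; apply: continuousD; [exact: cG|exact: cF].
  + have : 0 <= (dG t + dF t) * (b - a).
      rewrite mulr_ge0 ?subr_ge0 ?(ltW ab)//.
      by move: tab; rewrite in_itv/= => /FG; rewrite ler_norml; lra.
    by rewrite -[_ * _]tE -[(G + F) b]/(G b + F b) -[(G + F) a]/(G a + F a); lra.
- have [t||t tab tE] := @MVT R (G - F) (dG - dF) a b ab.
  + rewrite in_itv/= => tab.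
    exact: is_deriveB (dGP _ tab) (dFP _ tab).
  + by move=> t; apply: continuousD; [exact: cG|exact/continuousN/cF].
  + have : 0 <= (dG t - dF t) * (b - a).
      rewrite mulr_ge0 ?subr_ge0 ?(ltW ab)//.
      by move: tab; rewrite in_itv/= => /FG; rewrite ler_norml; lra.
    by rewrite -[_ * _]tE -[(G - F) b]/(G b - F b) -[(G - F) a]/(G a - F a); lra.
Qed.

Lemma within_continuousB (A : set R) (f g : R -> R) :
  {within A, continuous f} -> {within A, continuous g} ->
  {within A, continuous (fun t => f t - g t)}.
Proof. by move=> cf cg t; apply: continuousD (cf t) _; exact/continuousN/cg. Qed.

Lemma within_continuousD (A : set R) (f g : R -> R) :
  {within A, continuous f} -> {within A, continuous g} ->
  {within A, continuous (fun t => f t + g t)}.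
Proof. by move=> cf cg t; exact: continuousD (cf t) (cg t). Qed.

Lemma within_continuousM (A : set R) (f g : R -> R) :
  {within A, continuous f} -> {within A, continuous g} ->
  {within A, continuous (fun t => f t * g t)}.
Proof. by move=> cf cg t; exact: continuousM (cf t) (cg t). Qed.

Lemma within_continuous_cst (A : set R) (l : R) :
  {within A, continuous (fun=> l)}.
Proof. by move=> t; exact: cvg_cst. Qed.

(** At 0 the power need not be differentiable when p < 1, so continuity there comes from the
    one-sided limit. *)
Lemma within_continuous_powR (p : R) : 0 < p ->
  {within `[0, 1], continuous (@powR R ^~ p)}.
Proof.
move=> p0; apply/continuous_within_itvP => //; split.
- move=> t; rewrite in_itv/= => /andP[t0 _].
  exact: continuous_derive (is_derive1_powR p t0).
- by rewrite powR0 ?gt_eqF//; exact: powR_cvg0.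
- apply: cvg_at_left_filter.
  exact: continuous_derive (is_derive1_powR p ltr01).
Qed.

End interval_lemmas.

(** * The kernel t (c - t^kappa) and its weighted integrals *)

Section kernel.
Context {R : realType}.
Variables (kappa lambda : R).
Hypotheses (kappa_gt0 : 0 < kappa) (lambda01 : 0 <= lambda <= 1).
Let c := (kappa + 1) * lambda.

(** For [beta] nonnegative, the primitive of t (c - t^kappa) t^beta that vanishes at 0. The
    exponents 0 and [alpha] lead to [phi1] and [phi2]. *)
Let primitive (beta t : R) :=
  c / (beta + 2) * t `^ (beta + 2)
  - (kappa + beta + 2)^-1 * t `^ (kappa + beta + 2).

Let is_derive_primitive (beta t : R) : 0 <= beta -> 0 < t ->
  is_derive t 1 (primitive beta) (t * (c - t `^ kappa) * t `^ beta).
Proof.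
move=> beta0 t0.
apply: (is_derive_ext (is_deriveB
  (is_deriveZ (c / (beta + 2)) (is_derive1_powR (beta + 2) t0))
  (is_deriveZ (kappa + beta + 2)^-1 (is_derive1_powR (kappa + beta + 2) t0)))) => //.
have t_neq0 : t != 0 by rewrite gt_eqF.
have -> : beta + 2 - 1 = beta + 1 by ring.
have -> : kappa + beta + 2 - 1 = kappa + beta + 1 by ring.
rewrite !powRD ?t_neq0 ?implybT// powRr1 ?ltW// /GRing.scale/=.
by have k0 := kappa_gt0; field; apply/andP; split; apply: lt0r_neq0; lra.
Qed.

Let within_continuous_primitive (beta : R) : 0 <= beta ->
  {within `[0, 1], continuous (primitive beta)}.
Proof.
have k0 := kappa_gt0; move=> beta0.
by apply: within_continuousB; apply: within_continuousM;
  try exact: within_continuous_cst; apply: within_continuous_powR; lra.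
Qed.

Let primitive0 (beta : R) : 0 <= beta -> primitive beta 0 = 0.
Proof.
by move=> beta0; rewrite /primitive !powR0 ?mulr0 ?subr0//;
  have k0 := kappa_gt0; apply: lt0r_neq0; lra.
Qed.

Let primitive1 (beta : R) :
  primitive beta 1 = c / (beta + 2) - (kappa + beta + 2)^-1.
Proof. by rewrite /primitive !powR1 !mulr1. Qed.

Let c_ge0 : 0 <= c.
Proof. by move: lambda01 => /andP[l0 _]; rewrite mulr_ge0// addr_ge0// ltW. Qed.

(* the point where [c - t `^ kappa] changes sign *)
Let t0 := c `^ kappa^-1.

Let t0_kappa : t0 `^ kappa = c.
Proof. by rewrite /t0 -powRrM mulVf ?gt_eqF// powRr1. Qed.

(** The kernel is nonnegative before [t0] and nonpositive after it, so the integral of its absolute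
    value is P(t0) - (P(1) - P(t0)), with P the primitive. *)
Let phi2_small (beta : R) : 0 <= beta -> lambda <= (kappa + 1)^-1 ->
  phi2 kappa lambda beta = 2 * primitive beta t0 - primitive beta 1.
Proof.
move=> beta0 lk; rewrite /phi2 lk primitive1 -/c /primitive.
have -> : c `^ ((kappa + beta + 2) / kappa) = t0 `^ (kappa + beta + 2).
  by rewrite /t0 -powRrM mulrC.
(* Since t0^kappa = c, both terms of the primitive at [t0] are multiples of one power. *)
have -> : t0 `^ (kappa + beta + 2) = c * t0 `^ (beta + 2).
  rewrite -addrA (@powRD _ t0 kappa (beta + 2)) ?t0_kappa//.
  have k0 := kappa_gt0; apply/implyP => /eqP; lra.
by have k0 := kappa_gt0; field; apply/andP; split; apply: lt0r_neq0; lra.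
Qed.

(** Here c > 1, so the kernel keeps a nonnegative sign on all of [0, 1]. *)
Let phi2_large (beta : R) : (kappa + 1)^-1 < lambda ->
  phi2 kappa lambda beta = primitive beta 1.
Proof. by move=> lk; rewrite /phi2 leNgt lk/= primitive1. Qed.

Let kappa1_gt0 : 0 < kappa + 1. Proof. by rewrite addr_gt0. Qed.

Let c_le1 : (lambda <= (kappa + 1)^-1) = (c <= 1).
Proof. by rewrite -ler_pdivlMl// mulr1. Qed.

Lemma phi1E : phi1 kappa lambda = phi2 kappa lambda 0.
Proof.
rewrite /phi1 /phi2 addr0 add0r; case: ifP => // _.
by have k0 := kappa_gt0; congr (_ - _ + _); field; apply: lt0r_neq0; lra.
Qed.

(** Reduces the weight 1 - t^alpha to the weights 1 and t^alpha, for which explicit primitives are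
    at hand. *)
Lemma phi3E (alpha : R) : 0 <= alpha ->
  phi3 kappa lambda alpha = phi1 kappa lambda - phi2 kappa lambda alpha.
Proof.
move=> alpha0; rewrite /phi1 /phi2 /phi3; case: ifP => _.
  set u := _ `^ _; set v := _ `^ _.
  by have k0 := kappa_gt0; field; rewrite !lt0r_neq0//; lra.
by have k0 := kappa_gt0; field; rewrite !lt0r_neq0//; lra.
Qed.

(* With [k t := t * (c - t `^ kappa)], the function
   [k F1 - k' F - kappa (kappa + 1) J] is a primitive of [k F2]. *)
Lemma kernel_bound (alpha A B : R) (F F1 F2 J : R -> R) : 0 <= alpha ->
  (forall t : R, 0 <= t <= 1 -> is_derive t 1 F (F1 t)) ->
  (forall t : R, 0 <= t <= 1 -> is_derive t 1 F1 (F2 t)) ->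
  {within `[0, 1], continuous J} -> J 0 = 0 ->
  (forall t : R, 0 < t < 1 -> is_derive t 1 J (t `^ (kappa - 1) * F t)) ->
  (forall t : R, 0 < t < 1 -> `|F2 t| <= A + B * t `^ alpha) ->
  `|(c - 1) * F1 1 - (c - (kappa + 1)) * F 1 + c * F 0
    - (kappa + 1) * kappa * J 1| <=
  A * phi1 kappa lambda + B * phi2 kappa lambda alpha.
Proof.
move=> alpha0 dF dF1 cJ J0 dJ F2le.
pose k t := c * t - t `^ (kappa + 1).
pose k' t := c - (kappa + 1) * t `^ kappa.
pose Phi t := k t * F1 t - k' t * F t - (kappa + 1) * kappa * J t.
pose K t := A * primitive 0 t + B * primitive alpha t.
pose dPhi t := t * (c - t `^ kappa) * F2 t.
pose dK t := t * (c - t `^ kappa) * (A + B * t `^ alpha).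
have cF : {within `[0, 1], continuous F}.
  by apply: derivable_within_continuous => t; rewrite in_itv/= => /dF.
have cF1 : {within `[0, 1], continuous F1}.
  by apply: derivable_within_continuous => t; rewrite in_itv/= => /dF1.
have cpow p : 0 < p -> {within `[0, 1], continuous (fun t : R => t `^ p)}.
  exact: within_continuous_powR.
have cPhi : {within `[0, 1], continuous Phi}.
  apply: within_continuousB; last first.
    by apply: within_continuousM => //; exact: within_continuous_cst.
  apply: within_continuousB; apply: within_continuousM => //.
    apply: within_continuousB; last exact: cpow.
    apply: within_continuousM; first exact: within_continuous_cst.
    by apply: continuous_subspaceT => x; exact: cvg_id.
  apply: within_continuousB; first exact: within_continuous_cst.
  apply: within_continuousM; first exact: within_continuous_cst.
  exact: cpow.
have cK : {within `[0, 1], continuous K}.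
  by apply: within_continuousD; apply: within_continuousM;
    try exact: within_continuous_cst; exact: within_continuous_primitive.
have Phi' (t : R) : 0 < t < 1 -> is_derive t 1 Phi (dPhi t).
  move=> t01; move: (t01) => /andP[tp /ltW t1].
  have t01' : 0 <= t <= 1 by rewrite (ltW tp).
  have t_neq0 : t != 0 by rewrite gt_eqF.
  have dk := is_deriveB (is_deriveZ c (is_derive_id t 1))
    (is_derive1_powR (kappa + 1) tp).
  have dk' := is_deriveB (is_derive_cst c t 1)
    (is_deriveZ (kappa + 1) (is_derive1_powR kappa tp)).
  apply: (is_derive_ext (is_deriveB (is_deriveB
    (is_deriveM dk (dF1 _ t01')) (is_deriveM dk' (dF _ t01')))
    (is_deriveZ ((kappa + 1) * kappa) (dJ _ t01)))) => //.
  rewrite /dPhi /GRing.scale/= addrK.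
  rewrite -[(_ - _) t]/(c * t - t `^ (kappa + 1)).
  rewrite -[(_ - _) t]/(c - (kappa + 1) * t `^ kappa).
  rewrite powRD ?t_neq0 ?implybT// powRr1 ?(ltW tp)//; ring.
have K' (t : R) : 0 < t -> is_derive t 1 K (dK t).
  move=> tp; apply: (is_derive_ext (is_deriveD
    (is_deriveZ A (is_derive_primitive (lexx 0) tp))
    (is_deriveZ B (is_derive_primitive alpha0 tp)))) => //.
  by rewrite /dK powRr0 /GRing.scale/=; ring.
(* At 0 only k' survives, with k'(0) = c; at 1, k(1) = c - 1 and k'(1) = c - (kappa + 1). *)
have Phi0 : Phi 0 = - (c * F 0).
  by rewrite /Phi /k /k' J0 !powR0 ?gt_eqF//; ring.
have K0 : K 0 = 0 by rewrite /K !primitive0// !mulr0 addr0.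
have -> : (c - 1) * F1 1 - (c - (kappa + 1)) * F 1 + c * F 0
    - (kappa + 1) * kappa * J 1 = Phi 1 - Phi 0.
  by rewrite Phi0 /Phi /k /k' !powR1; ring.
have dPhi_le t : 0 < t < 1 -> t `^ kappa <= c -> `|dPhi t| <= dK t.
  move=> t01 tc; have tp : 0 <= t by case/andP: t01 => /ltW.
  have kt : 0 <= t * (c - t `^ kappa) by rewrite mulr_ge0// subr_ge0.
  by rewrite normrM ger0_norm// ler_wpM2l// F2le.
have dPhi_ge t : 0 < t < 1 -> c <= t `^ kappa -> `|dPhi t| <= - dK t.
  move=> t01 ct; have tp : 0 <= t by case/andP: t01 => /ltW.
  have kt : t * (c - t `^ kappa) <= 0 by rewrite mulr_ge0_le0// subr_le0.
  by rewrite normrM ler0_norm// -[leRHS]mulNr ler_wpM2l ?oppr_ge0// F2le.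
have phi_large : (kappa + 1)^-1 < lambda ->
    A * phi1 kappa lambda + B * phi2 kappa lambda alpha = K 1.
  by move=> lk; rewrite phi1E !phi2_large.
have phi_small : lambda <= (kappa + 1)^-1 ->
    A * phi1 kappa lambda + B * phi2 kappa lambda alpha = K t0 + (K t0 - K 1).
  by move=> lk; rewrite phi1E !phi2_small// /K; ring.
(* From here on only the recorded derivatives, end values and bounds of these four functions
   matter. *)
clearbody Phi K dPhi dK.
have sub01 u v : 0 <= u -> v <= 1 -> `[u, v] `<=` `[0 : R, 1].
  by move=> u0 v1; apply: subset_itvScc; rewrite bnd_simp.
have pow_mono (u v : R) : 0 <= u -> u <= v -> u `^ kappa <= v `^ kappa.
  move=> u0 uv; rewrite ge0_ler_powR ?nnegrE ?(ltW kappa_gt0)//.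
  exact: le_trans uv.
(* Used with v = 1 when there is no sign change before 1, and with v = t0 otherwise. *)
have up (v : R) : 0 <= v <= 1 -> v `^ kappa <= c -> `|Phi v - Phi 0| <= K v.
  move=> /andP[v0 v1] vc; have -> : K v = K v - K 0 by rewrite K0 subr0.
  apply: (ler_dist_derive v0 (dF := dPhi) (dG := dK)).
  - exact: continuous_subspaceW (sub01 _ _ (lexx 0) v1) cPhi.
  - exact: continuous_subspaceW (sub01 _ _ (lexx 0) v1) cK.
  - by move=> t /andP[tp tv]; apply: Phi'; rewrite tp (lt_le_trans tv).
  - by move=> t /andP[tp _]; exact: K'.
  - move=> t /andP[tp tv]; apply: dPhi_le; first by rewrite tp (lt_le_trans tv).
    by rewrite (le_trans _ vc)// pow_mono// ltW.
have [lk|lk] := leP lambda (kappa + 1)^-1; last first.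
  rewrite phi_large//; apply: up; rewrite ?ler01 ?lexx// powR1.
  by rewrite leNgt; apply/negP => /ltW; rewrite -c_le1 leNgt lk.
have c1 : c <= 1 by rewrite -c_le1.
have t00 : 0 <= t0 by exact: powR_ge0.
have t01 : t0 <= 1.
  suff : t0 <= 1 `^ kappa^-1 by rewrite powR1.
  by rewrite ge0_ler_powR ?nnegrE ?invr_ge0 ?(ltW kappa_gt0).
have upt0 : `|Phi t0 - Phi 0| <= K t0 by apply: up; rewrite ?t00// t0_kappa.
(* Past [t0] the kernel is nonpositive, so -K is the dominating primitive. *)
have down : `|Phi 1 - Phi t0| <= - K 1 - - K t0.
  apply: (ler_dist_derive t01 (G := fun t => - K t) (dF := dPhi)
    (dG := fun t => - dK t)).
  - exact: continuous_subspaceW (sub01 _ _ t00 (lexx 1)) cPhi.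
  - move=> t; apply: continuousN.
    exact: (continuous_subspaceW (sub01 _ _ t00 (lexx 1)) cK).
  - by move=> t /andP[tt0 t1]; apply: Phi'; rewrite t1 andbT (le_lt_trans _ tt0).
  - by move=> t /andP[tt0 _]; apply: is_deriveN; apply: K';
      rewrite (le_lt_trans _ tt0).
  - move=> t /andP[tt0 t1]; apply: dPhi_ge.
      by rewrite t1 andbT (le_lt_trans _ tt0).
    by rewrite -t0_kappa pow_mono// ltW.
have -> : Phi 1 - Phi 0 = (Phi t0 - Phi 0) + (Phi 1 - Phi t0) by ring.
rewrite phi_small//; apply: (le_trans (ler_normD _ _)); rewrite lerD//.
by rewrite (le_trans down)// opprK addrC.
Qed.

End kernel.

(** * From tangent lines to the Hoelder form *)

Section hoelder.
Context {R : realType}.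
Implicit Types q x y z : R.

(** Young's inequality for the product of r = y^(1/q) / z and 1 gives r <= r^q / q + 1 - 1/q;
    multiply by z. The right-hand side is the tangent at z^q. *)
Lemma powR_tangent q y z : 1 <= q -> 0 <= y -> 0 < z ->
  y `^ q^-1 <= (1 - q^-1) * z + q^-1 * z `^ (1 - q) * y.
Proof.
move=> q1 y0 z0; have q0 : 0 < q by exact: lt_le_trans q1.
have z_neq0 : z != 0 by rewrite gt_eqF.
(* For q = 1 the conjugate exponent is infinite, but both sides equal y. *)
move: q1; rewrite le_eqVlt => /predU1P[<-|q1].
  by rewrite invr1 !subrr mul0r add0r powRr0 !mul1r powRr1.
pose r := y `^ q^-1 / z.
have r0 : 0 <= r by rewrite divr_ge0 ?powR_ge0 ?ltW.
have rq : r `^ q = y * z `^ (- q).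
  rewrite powRM ?powR_ge0 ?invr_ge0 ?(ltW z0)//.
  by rewrite -powRrM mulVf ?gt_eqF// powRr1// -powR_inv1 ?ltW// -powRrM mulN1r.
have q'0 : 0 < 1 - q^-1 by rewrite subr_gt0 invf_lt1.
have qq' : q^-1 + (1 - q^-1)^-1^-1 = 1 by rewrite invrK addrC subrK.
have := conjugate_powR r0 ler01 q0 (_ : 0 < (1 - q^-1)^-1) qq'.
rewrite invr_gt0 => /(_ q'0); rewrite mulr1 powR1 mul1r invrK rq.
rewrite -(ler_pM2r z0) /r divfK// => /le_trans; apply.
by rewrite powRD ?z_neq0 ?implybT// powRr1 ?(ltW z0)// le_eqVlt;
  apply/orP; left; apply/eqP; ring.
Qed.

(** For S > 0 the bound is minimal at z^q = S / f, where it equals z f = f^(1 - 1/q) S^(1/q). For S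
    = 0 the infimum is approached as z tends to 0. *)
Lemma powR_tangent_opt q x f S : 1 <= q -> 0 <= f -> 0 <= S ->
  (f = 0 -> S = 0) ->
  (forall z, 0 < z -> x <= (1 - q^-1) * z * f + q^-1 * z `^ (1 - q) * S) ->
  x <= f `^ (1 - q^-1) * S `^ q^-1.
Proof.
move=> q1 f0 S0 fS xz; have q0 : 0 < q by exact: lt_le_trans q1.
have [S_eq0|S_neq0] := eqVneq S 0.
  rewrite S_eq0 powR0 ?invr_neq0 ?gt_eqF// mulr0 leNgt; apply/negP => x0.
  have f1 : 0 < f + 1 by rewrite ltr_wpDl.
  (* If x > 0, this [z] makes x = 2 z f + 2 z, which exceeds the bound z f. *)
  pose z := x / (2 * (f + 1)).
  have z0 : 0 < z by rewrite divr_gt0 ?mulr_gt0.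
  have := xz _ z0; rewrite S_eq0 mulr0 addr0 => xzf.
  have : (1 - q^-1) * z * f <= z * f.
    rewrite ler_wpM2r// ler_piMl ?(ltW z0)//.
    by rewrite gerDl oppr_le0 invr_ge0 ltW.
  have xE : x = z * (2 * (f + 1)) by rewrite /z divfK// lt0r_neq0// mulr_gt0.
  have zf : 0 <= z * f by rewrite mulr_ge0 ?(ltW z0).
  lra.
have Sp : 0 < S by rewrite lt0r S_neq0.
have f_neq0 : f != 0 by apply: contra_neq S_neq0.
have fp : 0 < f by rewrite lt0r f_neq0.
pose z := (S / f) `^ q^-1.
have z0 : 0 < z by rewrite powR_gt0 ?divr_gt0.
have zq : z `^ (1 - q) = z * (f / S).
  rewrite powRD ?(gt_eqF z0) ?implybT// powRr1 ?(ltW z0)//; congr (_ * _).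
  by rewrite /z -powRrM mulrN mulVf ?gt_eqF// powR_inv1 ?divr_ge0// invf_div.
apply: (le_trans (xz _ z0)); rewrite zq le_eqVlt; apply/orP; left; apply/eqP.
transitivity (z * f); first by field; rewrite S_neq0 gt_eqF.
rewrite powRD ?f_neq0 ?implybT// powRr1// /z powRM ?invr_ge0//.
by rewrite -[f^-1]powR_inv1// -powRrM mulN1r; ring.
Qed.

Variables (kappa lambda : R).
Hypotheses (kappa_gt0 : 0 < kappa) (lambda01 : 0 <= lambda <= 1).

(** [kernel_bound] for zero functions has this quantity as upper bound of an absolute value. *)
Let phi_ge0 (alpha A B : R) : 0 <= alpha ->
  (forall t : R, 0 < t < 1 -> 0 <= A + B * t `^ alpha) ->
  0 <= A * phi1 kappa lambda + B * phi2 kappa lambda alpha.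
Proof.
move=> alpha0 AB; apply: le_trans (normr_ge0 _) _.
apply: (@kernel_bound _ _ _ kappa_gt0 lambda01 alpha A B
  (cst 0) (cst 0) (cst 0) (cst 0)) => //.
- exact: within_continuous_cst.
- by move=> ? _; rewrite mulr0; exact: is_derive_cst.
- by move=> t t01; rewrite normr0 AB.
Qed.

Let powR01 (alpha t : R) : 0 <= alpha -> 0 < t < 1 -> 0 <= t `^ alpha <= 1.
Proof.
move=> alpha0 /andP[t0 t1]; rewrite powR_ge0/=.
by rewrite -[leRHS](powRr0 t); apply: ger_powR => //; rewrite t0 ltW.
Qed.

Lemma phi2_ge0 (alpha : R) : 0 <= alpha -> 0 <= phi2 kappa lambda alpha.
Proof.
move=> alpha0; have := @phi_ge0 alpha 0 1 alpha0.
by rewrite mul0r mul1r add0r; apply => t _; rewrite mul1r add0r powR_ge0.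
Qed.

Lemma phi3_ge0 (alpha : R) : 0 <= alpha -> 0 <= phi3 kappa lambda alpha.
Proof.
move=> alpha0; have := @phi_ge0 alpha 1 (-1) alpha0.
rewrite mulN1r mul1r -phi3E//; apply => t t01.
by rewrite mulN1r subr_ge0; case/andP: (powR01 alpha0 t01).
Qed.

(** For each z > 0, [powR_tangent] makes the bound on [F2] affine in t^alpha, [kernel_bound] turns
    it into a bound on the increment, and [powR_tangent_opt] selects the best z. *)
Lemma kernel_hoelder_bound (alpha q D P Q : R) (F F1 F2 J : R -> R) :
  0 <= alpha -> 1 <= q -> 0 <= D -> 0 <= P -> 0 <= Q ->
  (forall t : R, 0 <= t <= 1 -> is_derive t 1 F (F1 t)) ->
  (forall t : R, 0 <= t <= 1 -> is_derive t 1 F1 (F2 t)) ->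
  {within `[0, 1], continuous J} -> J 0 = 0 ->
  (forall t : R, 0 < t < 1 -> is_derive t 1 J (t `^ (kappa - 1) * F t)) ->
  (forall t : R, 0 < t < 1 ->
    `|F2 t| <= D * (t `^ alpha * P + (1 - t `^ alpha) * Q) `^ q^-1) ->
  `|((kappa + 1) * lambda - 1) * F1 1
    - ((kappa + 1) * lambda - (kappa + 1)) * F 1
    + (kappa + 1) * lambda * F 0 - (kappa + 1) * kappa * J 1| <=
  D * (phi1 kappa lambda `^ (1 - q^-1)
       * (P * phi2 kappa lambda alpha + Q * phi3 kappa lambda alpha) `^ q^-1).
Proof.
move=> alpha0 q1 D0 P0 Q0 dF dF1 cJ J0 dJ F2le.
set X := `|_|; set S := P * _ + _.
have q0 : 0 < q by exact: lt_le_trans q1.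
have f2 := phi2_ge0 alpha0; have f3 := phi3_ge0 alpha0.
have f3E := phi3E lambda kappa_gt0 alpha0.
have f1 : 0 <= phi1 kappa lambda by lra.
have S0 : 0 <= S by rewrite addr_ge0 ?mulr_ge0.
(* [phi2] and [phi3] are nonnegative with sum [phi1], so they vanish with it. *)
have fS : phi1 kappa lambda = 0 -> S = 0.
  move=> f10; have f20 : phi2 kappa lambda alpha = 0 by lra.
  by rewrite /S f3E f10 f20 subrr !mulr0 addr0.
have Xz z : 0 < z ->
    X <= D * ((1 - q^-1) * z * phi1 kappa lambda + q^-1 * z `^ (1 - q) * S).
  move=> z0; pose w := q^-1 * z `^ (1 - q).
  (* Coefficients of D times the tangent bound at y = Q + (P - Q) t^alpha. *)
  pose A := D * ((1 - q^-1) * z + w * Q); pose B := D * (w * (P - Q)).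
  have := @kernel_bound _ _ _ kappa_gt0 lambda01 alpha A B F F1 F2 J
    alpha0 dF dF1 cJ J0 dJ.
  rewrite -/X => /(_ _)/le_trans; apply; last first.
    by rewrite le_eqVlt /S f3E /A /B /w; apply/orP; left; apply/eqP; ring.
  move=> t t01; have /andP[ta0 ta1] := powR01 alpha0 t01.
  apply: (le_trans (F2le _ t01)).
  set y := _ + _ * Q.
  have y0 : 0 <= y by rewrite addr_ge0 ?mulr_ge0 ?subr_ge0.
  have -> : A + B * t `^ alpha = D * ((1 - q^-1) * z + w * y).
    by rewrite /A /B /y; ring.
  by rewrite ler_wpM2l// powR_tangent.
move: D0; rewrite le_eqVlt => /predU1P[D0|Dp].
  by rewrite -D0 mul0r; have := Xz 1 ltr01; rewrite -D0 mul0r.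
rewrite -ler_pdivrMl//; apply: powR_tangent_opt => // z z0.
by rewrite ler_pdivrMl// Xz.
Qed.

End hoelder.

(** * The estimates on [a, x] and [x, m b] *)

Section segments.
Context {R : realType}.
Notation mu := (@lebesgue_measure R).

Lemma is_derive_affine (F : R -> R) (p d t l : R) :
  is_derive (p + t * d) 1 F l -> is_derive t 1 (fun s => F (p + s * d)) (l * d).
Proof.
move=> dF; have da : is_derive t 1 (fun s => p + s * d) d.
  apply: (is_derive_ext (is_deriveD (is_derive_cst p t 1)
    (is_deriveZ d (is_derive_id t 1)))) => [s|].
    by rewrite -[_ s]/(p + d * s) mulrC.
  by rewrite add0r /GRing.scale/= mulr1.
exact: (@is_derive1_comp R F (fun s => p + s * d) t l d dF da).
Qed.

Lemma within_continuous_affine (F : R -> R) (a b p d : R) :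
  (forall t : R, 0 <= t <= 1 -> p + t * d \in `[a, b]) ->
  {within `[a, b], continuous F} ->
  {within `[0, 1], continuous (fun t => F (p + t * d))}.
Proof.
move=> sub /subspace_continuousP cF; apply/subspace_continuousP => t /=.
rewrite in_itv/= => t01 B /(cF _ (sub _ t01)) FB.
have cphi : {for t, continuous (fun s : R => p + s * d)}.
  exact: continuous_derive (is_derive_affine (is_derive_id (p + t * d) 1)).
have {}FB : \forall s \near t, `[a, b]%classic (p + s * d) -> B (F (p + s * d)).
  exact: cphi _ FB.
rewrite /nbhs/= /within/=; near=> s => s01.
have : `[a, b]%classic (p + s * d) -> B (F (p + s * d)) by near: s; exact: FB.
by apply; apply: sub; move: s01; rewrite in_itv.
Unshelve. all: by end_near. Qed.

(** A continuous factor is bounded on a compact interval. This is applied to the singular weights,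
    which are only integrable. *)
Lemma integrableM_continuous (w f : R -> R) (a b : R) :
  mu.-integrable `[a, b] (EFin \o w) -> {within `[a, b], continuous f} ->
  mu.-integrable `[a, b] (EFin \o (fun t => w t * f t)).
Proof.
move=> iw cf; apply: (integrableMl _ iw) => //.
  exact: subspace_continuous_measurable_fun.
have /compact_bounded[M [_ Mf]] := continuous_compact cf (@segment_compact R a b).
by exists M; split; rewrite ?num_real// => ? ? ? ?; exact: Mf.
Qed.

Lemma is_derive_integral (u : R -> R) (a b y : R) :
  mu.-integrable `[a, b] (EFin \o u) -> a < y < b -> {for y, continuous u} ->
  is_derive y 1 (fun y => \int[mu]_(t in `[a, y]) u t) (u y).
Proof.
move=> iu /andP[ay yb] cu.
have [dG <-] := continuous_FTC1_closed yb iu ay cu.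
by rewrite derive1E; exact: derivableP dG.
Qed.

Variables (kappa lambda alpha q : R).
Hypotheses (kappa_gt0 : 0 < kappa) (lambda01 : 0 <= lambda <= 1).
Hypotheses (alpha_ge0 : 0 <= alpha) (q_ge1 : 1 <= q).

(** In the application P is |f''(x)|^q and Q is m |f''(v)|^q, where v is a/m on the left segment and
    b on the right one. *)
Let side (P Q : R) := phi1 kappa lambda `^ (1 - q^-1)
  * (P * phi2 kappa lambda alpha + Q * phi3 kappa lambda alpha) `^ q^-1.

(** Serves both segments: [p] is the outer endpoint and d = x - p is signed. The chain rule puts d^2
    in front of f'', which is nonnegative in either direction. *)
Let segment_bound (P Q : R) (f J : R -> R) (p d : R) :
  0 <= P -> 0 <= Q ->
  (forall t : R, 0 <= t <= 1 ->
    derivable f (p + t * d) 1 /\ derivable (derive1 f) (p + t * d) 1) ->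
  {within `[0, 1], continuous J} -> J 0 = 0 ->
  (forall t : R, 0 < t < 1 ->
    is_derive t 1 J (t `^ (kappa - 1) * f (p + t * d))) ->
  (forall t : R, 0 < t < 1 ->
    `|derive1n 2 f (p + t * d)| `^ q <= t `^ alpha * P + (1 - t `^ alpha) * Q) ->
  `|((kappa + 1) * lambda - 1) * (derive1 f (p + d) * d)
    - ((kappa + 1) * lambda - (kappa + 1)) * f (p + d)
    + (kappa + 1) * lambda * f p - (kappa + 1) * kappa * J 1| <=
  d ^+ 2 * side P Q.
Proof.
move=> P0 Q0 df cJ J0 dJ f2le.
have d0 : 0 <= d ^+ 2 by rewrite sqr_ge0.
have := @kernel_hoelder_bound _ _ _ kappa_gt0 lambda01 alpha q (d ^+ 2) P Q
  (fun t => f (p + t * d)) (fun t => derive1 f (p + t * d) * d)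
  (fun t => derive1n 2 f (p + t * d) * d * d) J alpha_ge0 q_ge1 d0 P0 Q0.
rewrite !mul1r mul0r addr0; apply => //.
- move=> t t01; apply: is_derive_affine.
  by rewrite derive1E; apply/derivableP; case: (df _ t01).
- move=> t t01.
  have dd : is_derive (p + t * d) 1 (derive1 f) (derive1n 2 f (p + t * d)).
    by rewrite derive1nS derive1n1 derive1E; apply/derivableP; case: (df _ t01).
  apply: (is_derive_ext (is_deriveZ d (is_derive_affine dd))) => [s|].
    by rewrite mulrC.
  by rewrite /GRing.scale/= mulrC.
- move=> t t01; rewrite -mulrA normrM -expr2 (ger0_norm d0) mulrC ler_wpM2l//.
  have q0 : 0 < q by exact: lt_le_trans q_ge1.
  have -> : `|derive1n 2 f (p + t * d)| =
      (`|derive1n 2 f (p + t * d)| `^ q) `^ q^-1.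
    by rewrite -powRrM divff ?powRr1// lt0r_neq0.
  have := f2le _ t01; set y := _ + _ => f2y.
  by rewrite ge0_ler_powR ?nnegrE ?invr_ge0 ?(ltW q0) ?powR_ge0//
    (le_trans _ f2y) ?powR_ge0.
Qed.

Let h2 (h : R) : 0 <= h -> h `^ (kappa + 2) = h `^ kappa * h ^+ 2.
Proof.
move=> h0; rewrite powRD ?powR_mulrn//; apply/implyP => /eqP.
have k0 := kappa_gt0; lra.
Qed.

Let h1 (h : R) : 0 <= h -> h `^ (kappa + 1) = h `^ kappa * h.
Proof.
move=> h0; rewrite powRD ?powRr1//; apply/implyP => /eqP.
have k0 := kappa_gt0; lra.
Qed.

(** This is [segment_bound] from [a] with d = h = x - a, multiplied by h^kappa / (kappa + 1). *)
Lemma left_bound (P Q : R) (f : R -> R) (a x : R) : 0 <= P -> 0 <= Q ->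
  a <= x ->
  (forall y, a <= y <= x -> derivable f y 1 /\ derivable (derive1 f) y 1) ->
  (forall t : R, 0 < t < 1 ->
    `|derive1n 2 f (a + t * (x - a))| `^ q <=
      t `^ alpha * P + (1 - t `^ alpha) * Q) ->
  `|(1 - lambda) * (x - a) `^ kappa * f x + lambda * (x - a) `^ kappa * f a
    - ((kappa + 1)^-1 - lambda) * (x - a) `^ (kappa + 1) * derive1 f x
    - kappa * \int[mu]_(t in `[a, x]) ((t - a) `^ (kappa - 1) * f t)| <=
  (x - a) `^ (kappa + 2) / (kappa + 1) * side P Q.
Proof.
(* On a degenerate segment both sides vanish: the powers of 0 have positive exponents and the
   integral is over a point. *)
move=> P0 Q0 + df f2le; rewrite le_eqVlt => /predU1P[<-|ax].
  have k0 := kappa_gt0.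
  rewrite subrr set_itv1 Rintegral_set1 !powR0 ?lt0r_neq0//; [|lra..].
  by rewrite !(mulr0, mul0r, subr0, addr0) normr0.
have h0 : 0 < x - a by rewrite subr_gt0.
set h := x - a in f2le h0 *.
have k_neq0 : kappa != 0 by rewrite gt_eqF.
have hk0 : 0 < h `^ kappa by rewrite powR_gt0.
have sub (t : R) : 0 <= t <= 1 -> a <= a + t * h <= x.
  move=> /andP[t0 t1]; rewrite lerDl mulr_ge0 ?(ltW h0)//=.
  by rewrite -lerBrDl ler_piMl// ltW.
have cf : {within `[a, x], continuous f}.
  by apply: derivable_within_continuous => y; rewrite in_itv/= => /df[].
pose u t := (t - a) `^ (kappa - 1) * f t.
have iu : mu.-integrable `[a, x] (EFin \o u).
  by apply: integrableM_continuous cf; exact: powR_sub_integrable.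
pose G y := \int[mu]_(t in `[a, y]) u t.
(* The integral of s^(kappa-1) f(a + s h) over [0, t], written in the original variable; its
   derivative is computed directly, so no change of variables is performed. *)
pose J t := (h `^ kappa)^-1 * G (a + t * h).
have cJ : {within `[0, 1], continuous J}.
  apply: within_continuousM; first exact: within_continuous_cst.
  apply: (@within_continuous_affine G a x) => [t /sub//|].
  exact: (parameterized_integral_continuous (ltW ax) iu).
have J0 : J 0 = 0.
  by rewrite /J /G mul0r addr0 set_itv1 Rintegral_set1 mulr0.
have dJ (t : R) : 0 < t < 1 ->
    is_derive t 1 J (t `^ (kappa - 1) * f (a + t * h)).
  move=> /andP[t0 t1].
  have ath : a < a + t * h < x.
    by rewrite ltrDl mulr_gt0//= -ltrBrDl gtr_pMl.
  have cu : {for a + t * h, continuous u}.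
    have t01 : 0 <= t <= 1 by rewrite !ltW.
    have [/derivableP dfy _] := df _ (sub _ t01).
    apply: continuousM; last exact: continuous_derive dfy.
    by apply: continuous_powR_sub; case/andP: ath.
  have dG := is_derive_integral iu ath cu.
  apply: (is_derive_ext (is_deriveZ (h `^ kappa)^-1 (is_derive_affine dG))) => //.
  rewrite /GRing.scale/= /u [a + t * h - a]addrC addKr.
  rewrite (powRM _ (ltW t0) (ltW h0)) -(mulr_powRB1 (ltW h0) kappa_gt0).
  by field; rewrite !lt0r_neq0 ?powR_gt0.
have := segment_bound P0 Q0 (fun t t01 => df _ (sub t t01)) cJ J0 dJ f2le.
rewrite /J mul1r [a + h]addrC subrK.
have hk1 : 0 < h `^ kappa / (kappa + 1) by rewrite divr_gt0// addr_gt0.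
rewrite -(ler_pM2l hk1) -{1}(gtr0_norm hk1) -normrM.
rewrite (h2 (ltW h0)) (h1 (ltW h0)).
set E := (X in `|X| <= _ -> _); set E' := (X in _ -> `|X| <= _).
have -> : E' = E.
  rewrite /E /E' /G; field; rewrite !lt0r_neq0//.
  by rewrite addr_gt0.
move=> /le_trans; apply; rewrite le_eqVlt; apply/orP; left; apply/eqP.
by move: (side P Q) => z; ring.
Qed.

(** The segment is run from [c] down to [x], so d = -h with h = c - x; this flips the sign of the f'
    term relative to [left_bound]. *)
Lemma right_bound (P Q : R) (f : R -> R) (x c : R) : 0 <= P -> 0 <= Q ->
  x <= c ->
  (forall y, x <= y <= c -> derivable f y 1 /\ derivable (derive1 f) y 1) ->
  (forall t : R, 0 < t < 1 ->
    `|derive1n 2 f (c + t * (x - c))| `^ q <=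
      t `^ alpha * P + (1 - t `^ alpha) * Q) ->
  `|(1 - lambda) * (c - x) `^ kappa * f x + lambda * (c - x) `^ kappa * f c
    + ((kappa + 1)^-1 - lambda) * (c - x) `^ (kappa + 1) * derive1 f x
    - kappa * \int[mu]_(t in `[x, c]) ((c - t) `^ (kappa - 1) * f t)| <=
  (c - x) `^ (kappa + 2) / (kappa + 1) * side P Q.
Proof.
move=> P0 Q0 + df f2le; rewrite le_eqVlt => /predU1P[<-|xc].
  have k0 := kappa_gt0.
  rewrite subrr set_itv1 Rintegral_set1 !powR0 ?lt0r_neq0//; [|lra..].
  by rewrite !(mulr0, mul0r, subr0, addr0) normr0.
have h0 : 0 < c - x by rewrite subr_gt0.
set h := c - x in h0 *.
have hE : x - c = - h by rewrite opprB.
have k_neq0 : kappa != 0 by rewrite gt_eqF.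
have hk0 : 0 < h `^ kappa by rewrite powR_gt0.
have sub (t : R) : 0 <= t <= 1 -> x <= c + t * (x - c) <= c.
  move=> /andP[t0 t1]; rewrite hE mulrN gerDl oppr_le0 mulr_ge0 ?(ltW h0)// andbT.
  by rewrite lerBrDr -lerBrDl ler_piMl// ltW.
have cf : {within `[x, c], continuous f}.
  by apply: derivable_within_continuous => y; rewrite in_itv/= => /df[].
pose u t := (c - t) `^ (kappa - 1) * f t.
have iu : mu.-integrable `[x, c] (EFin \o u).
  by apply: integrableM_continuous cf; exact: powR_rsub_integrable.
pose G y := \int[mu]_(t in `[x, y]) u t.
(* The difference is the integral from the moving point up to [c], expressed through a primitive
   based at [x]. *)
pose J t := (h `^ kappa)^-1 * (G c - G (c + t * (x - c))).
have cJ : {within `[0, 1], continuous J}.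
  apply: within_continuousM; first exact: within_continuous_cst.
  apply: within_continuousB; first exact: within_continuous_cst.
  apply: (@within_continuous_affine G x c) => [t /sub//|].
  exact: (parameterized_integral_continuous (ltW xc) iu).
have J0 : J 0 = 0 by rewrite /J mul0r addr0 subrr mulr0.
have dJ (t : R) : 0 < t < 1 ->
    is_derive t 1 J (t `^ (kappa - 1) * f (c + t * (x - c))).
  move=> /andP[t0 t1].
  have cth : x < c + t * (x - c) < c.
    rewrite hE mulrN gtrDl oppr_lt0 mulr_gt0// andbT.
    by rewrite ltrBrDr -ltrBrDl gtr_pMl.
  have cu : {for c + t * (x - c), continuous u}.
    have t01 : 0 <= t <= 1 by rewrite !ltW.
    have [/derivableP dfy _] := df _ (sub _ t01).
    apply: continuousM; last exact: continuous_derive dfy.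
    by apply: continuous_powR_rsub; case/andP: cth.
  have dG := is_derive_affine (is_derive_integral iu cth cu).
  apply: (is_derive_ext (is_deriveZ (h `^ kappa)^-1
    (is_deriveB (is_derive_cst (G c) t 1) dG))) => //.
  rewrite /GRing.scale/= /u.
  have -> : c - (c + t * (x - c)) = t * h by rewrite /h; ring.
  rewrite (powRM _ (ltW t0) (ltW h0)) -(mulr_powRB1 (ltW h0) kappa_gt0) hE.
  by field; rewrite !lt0r_neq0 ?powR_gt0.
have := segment_bound P0 Q0 (fun t t01 => df _ (sub t t01)) cJ J0 dJ f2le.
rewrite /J mul1r [c + (x - c)]addrC subrK /G set_itv1 Rintegral_set1 subr0 hE sqrrN.
have hk1 : 0 < h `^ kappa / (kappa + 1) by rewrite divr_gt0// addr_gt0.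
rewrite -(ler_pM2l hk1) -{1}(gtr0_norm hk1) -normrM.
rewrite (h2 (ltW h0)) (h1 (ltW h0)).
set E := (X in `|X| <= _ -> _); set E' := (X in _ -> `|X| <= _).
have -> : E' = E.
  rewrite /E /E'; field; rewrite !lt0r_neq0//.
  by rewrite addr_gt0.
move=> /le_trans; apply; rewrite le_eqVlt; apply/orP; left; apply/eqP.
by move: (side P Q) => z; ring.
Qed.

End segments.

(** * Assembly of the two halves *)

Lemma ler_norm_divD (R : realType) (x y u v d k z s t : R) : 0 < d -> 0 < k ->
  `|x| <= u / k * (z * s) -> `|y| <= v / k * (z * t) ->
  `|(x + y) / d| <= z * (u / (k * d) * s + v / (k * d) * t).
Proof.
move=> d0 k0 xs yt.
have -> : z * (u / (k * d) * s + v / (k * d) * t) =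
    (u / k * (z * s) + v / k * (z * t)) / d.
  by field; rewrite !lt0r_neq0.
rewrite normrM [X in _ * X]ger0_norm ?invr_ge0 ?(ltW d0)// ler_pM2r ?invr_gt0//.
exact: le_trans (ler_normD _ _) (lerD xs yt).
Qed.

Theorem theorem2 (R : realType) (I : set R) (f : R -> R) (a b alpha m q : R)
  (I_itv : is_interval I) (I_ge0 : I `<=` `[0, +oo[)
  (f_diff2 : forall y, I° y -> derivable f y 1 /\ derivable (derive1 f) y 1)
  (halpha : 0 <= alpha <= 1) (hm : 0 < m <= 1) (hq : 1 <= q)
  (amI : I° (a / m)) (bI : I° b) (abI : `[a, b] `<=` I°)
  (a_lt_mb : a < m * b)
  (f2_int : lebesgue_measure.-integrable `[a, b] (EFin \o derive1n 2 f))
  (f2_conv : am_convex alpha m a b (fun y => `|derive1n 2 f y| `^ q)) :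
  forall x lambda kappa : R,
    x \in `[a, m * b] -> 0 <= lambda <= 1 -> 0 < kappa ->
    `|If f x lambda kappa a (m * b)| <=
      phi1 kappa lambda `^ (1 - q^-1) *
      ((x - a) `^ (kappa + 2) / ((kappa + 1) * (m * b - a)) *
         (`|derive1n 2 f x| `^ q * phi2 kappa lambda alpha
          + m * `|derive1n 2 f (a / m)| `^ q * phi3 kappa lambda alpha) `^ q^-1
       + (m * b - x) `^ (kappa + 2) / ((kappa + 1) * (m * b - a)) *
         (`|derive1n 2 f x| `^ q * phi2 kappa lambda alpha
          + m * `|derive1n 2 f b| `^ q * phi3 kappa lambda alpha) `^ q^-1).
Proof.
move=> x lambda kappa; rewrite in_itv/= => /andP[ax xmb] lambda01 kappa_gt0.
have /andP[alpha0 _] := halpha; have /andP[m0 m1] := hm.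
have m_neq0 : m != 0 by rewrite gt_eqF.
(* Nonnegativity of [a] and [b] together with m <= 1 gives a <= a/m and m b <= b, which keeps all
   points used below inside [a, b]. *)
have I_nneg y : I° y -> 0 <= y.
  by move=> /interior_subset /I_ge0; rewrite /= in_itv/= andbT.
have b0 : 0 <= b by exact: I_nneg.
have mbb : m * b <= b by rewrite ler_piMl.
have a0 : 0 <= a.
  apply/I_nneg/abI; rewrite /= in_itv/= lexx/=.
  exact: ltW (lt_le_trans a_lt_mb mbb).
have xab : x \in `[a, b] by rewrite in_itv/= ax (le_trans xmb).
have bab : b \in `[a, b].
  by rewrite in_itv/= lexx andbT ltW// (lt_le_trans a_lt_mb).
have amab : a / m \in `[a, b].
  by rewrite in_itv/= ler_pdivlMr// ler_piMr//= ler_pdivrMr// mulrC ltW.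
have df y : a <= y <= m * b -> derivable f y 1 /\ derivable (derive1 f) y 1.
  move=> /andP[ay ymb]; apply/f_diff2/abI.
  by rewrite /= in_itv/= ay (le_trans ymb).
(* The convexity hypothesis at u = x and v: since p = m v, the combination t x + m (1 - t) v runs
   along the segment from p to x. The outer endpoints a and m b come from v = a/m and v = b. *)
have conv (v t p : R) : v \in `[a, b] -> p = m * v -> a <= p <= m * b ->
    0 < t < 1 ->
    `|derive1n 2 f (p + t * (x - p))| `^ q <=
    t `^ alpha * `|derive1n 2 f x| `^ q
    + (1 - t `^ alpha) * (m * `|derive1n 2 f v| `^ q).
  move=> vab pE /andP[ap pmb] /andP[t0 t1].
  have ptE : t * x + m * (1 - t) * v = p + t * (x - p) by rewrite pE; ring.
  have t01 : t \in `[0, 1] by rewrite in_itv/= !ltW.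
  have ptab : t * x + m * (1 - t) * v \in `[a, b].
    rewrite ptE in_itv/=; apply/andP; split; first by nra.
    by rewrite (le_trans _ mbb)//; nra.
  have := f2_conv x v t xab vab t01 ptab; rewrite ptE.
  by rewrite (mulrC m) -(mulrA _ m).
have mq v : 0 <= m * `|derive1n 2 f v| `^ q by rewrite mulr_ge0 ?powR_ge0 ?ltW.
pose EL := (1 - lambda) * (x - a) `^ kappa * f x + lambda * (x - a) `^ kappa * f a
  - ((kappa + 1)^-1 - lambda) * (x - a) `^ (kappa + 1) * derive1 f x
  - kappa * \int[lebesgue_measure]_(t in `[a, x]) ((t - a) `^ (kappa - 1) * f t).
pose ER := (1 - lambda) * (m * b - x) `^ kappa * f x
  + lambda * (m * b - x) `^ kappa * f (m * b)
  + ((kappa + 1)^-1 - lambda) * (m * b - x) `^ (kappa + 1) * derive1 f x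
  - kappa * \int[lebesgue_measure]_(t in `[x, m * b])
      ((m * b - t) `^ (kappa - 1) * f t).
have k10 : 0 < kappa + 1 by rewrite addr_gt0.
have mba0 : 0 < m * b - a by rewrite subr_gt0.
(* The quotient Gamma(kappa + 1) / Gamma(kappa) equals kappa, the factor before the integrals in
   [EL] and [ER]. *)
have -> : If f x lambda kappa a (m * b) = (EL + ER) / (m * b - a).
  rewrite /If /RL_left /RL_right Gamma_add1// /EL /ER.
  have := Gamma_gt0 kappa_gt0; move: mba0.
  move: (m * b - a) (Gamma kappa) ((x - a) `^ kappa) ((m * b - x) `^ kappa)
    ((x - a) `^ (kappa + 1)) ((m * b - x) `^ (kappa + 1))
    (Rintegral _ _ _) (Rintegral _ _ _).
  move=> d g hl hr hl1 hr1 il ir d0 g0.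
  by field; rewrite !lt0r_neq0.
apply: ler_norm_divD => //.
- apply: left_bound => //; rewrite ?powR_ge0 ?mq//.
  + by move=> y /andP[ay yx]; apply: df; rewrite ay (le_trans yx).
  + move=> t t01; apply: conv => //; first by rewrite mulrC divfK.
    by rewrite lexx ltW.
- apply: right_bound => //; rewrite ?powR_ge0 ?mq//.
  + by move=> y /andP[xy ymb]; apply: df; rewrite ymb (le_trans ax).
  + by move=> t t01; apply: conv => //; rewrite lexx ltW.
Qed.
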